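(* For every integer $n\ge 1$, $$\gamma^{p}_{I}(P_2\,\square\, P_n)=\begin{cases} n+1, & n\in\{1,3,5\},\\ n, & \text{otherwise},\end{cases}$$ where $P_k$ denotes the path on $k$ vertices.
   Context: All graphs are finite and simple. A perfect Italian dominating function (PID-function) of a graph $G$ is a function $f:V(G)\to\{0,1,2\}$ such that for every vertex $v$ with $f(v)=0$ we have $\sum_{u\in N(v)}f(u)=2$, where $N(v)$ is the open neighborhood of $v$. Its weight is $\sum_{u\in V(G)}f(u)$. The perfect Italian domination number $\gamma^{p}_{I}(G)$ is the minimum weight of a PID-function of $G$. The Cartesian product $G\square H$ has vertex set $V(G)\times V(H)$, with $(u_1,v_1)$ adjacent to $(u_2,v_2)$ iff either $u_1=u_2$ and $v_1v_2\in E(H)$, or $v_1=v_2$ and $u_1u_2\in E(G)$. *)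

(* Defs.v *)
From mathcomp Require Import all_boot.

Set Implicit Arguments.
Unset Strict Implicit.
Unset Printing Implicit Defensive.

Record sgraph := SGraph {
  vertex :> finType;
  adj : rel vertex;
  adj_sym : symmetric adj;
  adj_irrefl : irreflexive adj
}.

Section PerfectItalianDomination.
Variable G : sgraph.
Implicit Type f : {ffun G -> 'I_3}.

Definition PID_function f : bool :=
  [forall v : G, (f v == 0 :> nat) ==> (\sum_(u | adj v u) f u == 2)].

Definition weight f : nat := \sum_u f u.

Lemma PID_function_const1 : PID_function [ffun=> inord 1].
Proof. by apply/forallP => v; rewrite ffunE inordK. Qed.

(* The constant function 1 is a PID-function, so the minimum is taken over a
   nonempty set; see [PID_number_min]. *)
Definition PID_number : nat :=
  weight [arg min_(f < [ffun=> inord 1] | PID_function f) weight f].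

Lemma PID_number_min :
  (exists2 f, PID_function f & weight f = PID_number) /\
  (forall f, PID_function f -> PID_number <= weight f).
Proof.
rewrite /PID_number; case: arg_minnP => [|f fP fmin].
  exact: PID_function_const1.
by split=> //; exists f.
Qed.

End PerfectItalianDomination.

Section CartesianProduct.
Variables G H : sgraph.

Definition cart_adj : rel (G * H) := fun x y =>
  (x.1 == y.1) && adj x.2 y.2 || (x.2 == y.2) && adj x.1 y.1.

Lemma cart_adj_sym : symmetric cart_adj.
Proof.
move=> x y; rewrite /cart_adj [x.1 == _]eq_sym [x.2 == _]eq_sym.
by rewrite [adj x.1 _]adj_sym [adj x.2 _]adj_sym.
Qed.

Lemma cart_adj_irrefl : irreflexive cart_adj.
Proof. by move=> x; rewrite /cart_adj !adj_irrefl !andbF. Qed.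

Definition cart_prod : sgraph := SGraph cart_adj_sym cart_adj_irrefl.

End CartesianProduct.

Notation "G □ H" := (cart_prod G H) (at level 40, left associativity).

Section Path.
Variable n : nat.

Definition path_adj : rel 'I_n := fun i j => (i.+1 == j) || (j.+1 == i).

Lemma path_adj_sym : symmetric path_adj.
Proof. by move=> i j; rewrite /path_adj orbC. Qed.

Lemma path_adj_irrefl : irreflexive path_adj.
Proof. by move=> i; rewrite /path_adj orbb eqn_leq ltnn. Qed.

Definition path_graph : sgraph := SGraph path_adj_sym path_adj_irrefl.

End Path.

(* Main.v *)
(** A labelling of the ladder is a word of columns, and the PID condition only
involves three consecutive columns.  For the lower bound, a potential of two
consecutive columns bounds how far the number of columns from the second of them
on can exceed the weight after it; it drops by at least [1 - w] on reading a column of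
weight [w], and initially it is at most the weight of the first column, so the
total weight is at least [n].  For [n] in {1, 3, 5} the finitely many words of
weight at most [n] are checked to contain no PID-function.  Weight [n] is
attained by the zigzag (1,0)(0,1)(0,1)(1,0)(1,0)(0,1)... for even [n], and
for odd [n >= 7] by prefixing the five columns (1,0)(0,1)(0,0)(2,1)(0,0), of
weight 5, to a zigzag. *)
Require Import Defs.
From mathcomp Require Import all_boot zify.

(** * Words of columns and the local Italian condition *)

Definition column : Type := nat * nat.
Notation empty := ((0, 0) : column).
Definition colsum (c : column) := c.1 + c.2.

Definition cell_ok a left right across := (a == 0) ==> (left + right + across == 2).

Definition column_ok (p c q : column) :=
  cell_ok c.1 p.1 q.1 c.2 && cell_ok c.2 p.2 q.2 c.1.

(* [p] is the column to the left of the word; past the right end one reads the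
   column (0,0), so the boundary contributes nothing to the neighbour sums. *)
Fixpoint italian (p : column) (s : seq column) : bool :=
  if s is c :: s' then column_ok p c (head empty s') && italian c s' else true.

Definition total (s : seq column) := \sum_(c <- s) colsum c.

Lemma italianP p s :
  reflect (forall i, i < size s ->
             column_ok (nth empty (p :: s) i) (nth empty s i) (nth empty s i.+1))
          (italian p s).
Proof.
elim: s p => [|c s IHs] p /=; first exact: ReflectT.
apply: (iffP andP) => [[ok_c /IHs ok_s] [_|i i_lt] | ok_s].
- by case: (s) ok_c.
- exact: ok_s i_lt.
by split; [case: (s) (ok_s 0 isT) | apply/IHs => i; apply: (ok_s i.+1)].
Qed.

(** * Lower bound *)

(* The last summand is forced by the columns (1,1)(0,0)(1,1). *)
Definition potential (p c : column) : nat :=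
  (0 < c.1) + (0 < c.2) + [&& colsum c == 0, 0 < p.1 & 0 < p.2].

(** The critical case is [c] empty: each row of [p] and [q] then sums to 2, so either [p] is
    positive in both rows and the correction term counts, or [q] has an entry 2, which adds 2 to the
    weight but only 1 to the potential. *)
Lemma potential_step p c q :
  column_ok p c q -> potential c q < potential p c + colsum q.
Proof.
by case: p c q => [p1 p2] [c1 c2] [q1 q2]; rewrite /column_ok /cell_ok /potential /colsum /=; lia.
Qed.

Lemma potential_bound p c s :
  italian p (c :: s) -> size (c :: s) <= potential p c + total s.
Proof.
elim: s p c => [|q s IHs] p c /=.
  case: p c => [p1 p2] [c1 c2].
  by rewrite /total big_nil /column_ok /cell_ok /potential /colsum /=; lia.
case/andP=> /potential_step lt_q /IHs; rewrite /total big_cons /=; lia.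
Qed.

Lemma italian_total s : italian empty s -> size s <= total s.
Proof.
case: s => [//|c s] /potential_bound /leq_trans; apply.
by rewrite /total big_cons leq_add2r /potential /colsum andbF; case: c => [[|?] [|?]] /=; lia.
Qed.

Definition light_columns b : seq column :=
  [seq (i, j) | i <- iota 0 b.+1, j <- iota 0 (b - i).+1].

(** Entries are capped by the weight still available, so the candidates form an explicit list that
    computation can exhaust. *)
Fixpoint light_words n b : seq (seq column) :=
  if n is n'.+1
  then [seq c :: s | c <- light_columns b, s <- light_words n' (b - colsum c)]
  else [:: [::]].

Lemma mem_light_words s b : total s <= b -> s \in light_words (size s) b.
Proof.
elim: s b => [//|[i j] s IHs] b; rewrite /total big_cons => le_b.
rewrite [light_words _ _]/(allpairs_dep _ _ _).
apply/allpairsPdep; exists (i, j), s; split=> //.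
  apply/allpairsPdep; exists i, j; rewrite !mem_iota.
  by move: le_b; rewrite /colsum /=; split=> //; lia.
by apply: IHs; rewrite /total; lia.
Qed.

Lemma italian_total_exceptional s :
  size s \in [:: 1; 3; 5] -> italian empty s -> size s < total s.
Proof.
move=> s_exc s_ital; rewrite ltnNge; apply/negP => /mem_light_words.
have /allP none : all (fun w => ~~ italian empty w) (light_words (size s) (size s)).
  by move: s_exc; rewrite !inE => /or3P[] /eqP->; vm_compute.
by move/none; rewrite s_ital.
Qed.

(** * Constructions *)

Definition unit_column (b : bool) : column := (nat_of_bool b, nat_of_bool (~~ b)).

Fixpoint zigzag (b : bool) k : seq column :=
  if k is k'.+1 then [:: unit_column b, unit_column (~~ b) & zigzag (~~ b) k']
  else [::].

Lemma size_zigzag b k : size (zigzag b k) = k.*2.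
Proof. by elim: k b => //= k IHk b; rewrite IHk. Qed.

Lemma total_zigzag b k : total (zigzag b k) = k.*2.
Proof.
elim: k b => [|k IHk] b; first by rewrite /total big_nil.
by rewrite /total !big_cons -/(total _) IHk; case: b.
Qed.

(** The zero of the first column already gets 1 from across and 1 from the right, so [p] must vanish
    in its row. The zero of the second column gets 1 from the left and from across, and 0 from the
    equal column that follows. *)
Lemma italian_zigzag p b k :
  (if b then p.2 else p.1) = 0 -> italian p (zigzag b k).
Proof.
elim: k p b => [//|k IHk] [p1 p2] b /= p0.
rewrite IHk; last by case: b {p0}.
by case: b p0 => /= ->; case: k {IHk}.
Qed.

(** The fifth column needs (0,1) on its right to complement (2,1): hence a nonempty zigzag starting
    with [false]. *)
Definition odd_word k : seq column :=
  [:: (1, 0); (0, 1); (0, 0); (2, 1); (0, 0)] ++ zigzag false k.+1.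

Lemma ex_italian n : exists s,
  [/\ size s = n, all (fun c : column => (c.1 < 3) && (c.2 < 3)) s, italian empty s
    & total s = if n \in [:: 1; 3; 5] then n + 1 else n].
Proof.
have zz3 b k : all (fun c : column => (c.1 < 3) && (c.2 < 3)) (zigzag b k).
  by elim: k b => //= k IHk b; rewrite IHk; case: b.
have [n_exc|n_nexc] := boolP (n \in _).
  move: n_exc; rewrite !inE => /or3P[] /eqP->.
  - by exists [:: (1, 1)]; rewrite /total !big_cons big_nil.
  - by exists [:: (0, 0); (2, 2); (0, 0)]; rewrite /total !big_cons big_nil.
  by exists [:: (1, 1); (0, 0); (1, 1); (0, 0); (1, 1)]; rewrite /total !big_cons big_nil.
have [n_odd|n_even] := boolP (odd n); last first.
  exists (zigzag true n./2).
  by rewrite size_zigzag total_zigzag italian_zigzag // even_halfK.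
have [k ->] : exists k, n = 5 + k.+1.*2.
  exists (n./2 - 3); move: n_nexc n_odd; rewrite !inE; lia.
exists (odd_word k); split.
- by rewrite size_cat size_zigzag.
- by rewrite all_cat zz3.
- by rewrite /= italian_zigzag // andbT; case: k.
by rewrite /total big_cat -/(total (zigzag _ _)) total_zigzag !big_cons big_nil.
Qed.

(** * Labellings of the ladder as words of columns *)

Section Ladder.
Variable n : nat.
Notation ladder := (path_graph 2 □ path_graph n).
Implicit Type f : {ffun ladder -> 'I_3}.

Definition columns f : seq column :=
  [seq (nat_of_ord (f (ord0, i)), nat_of_ord (f (ord_max, i))) | i <- enum 'I_n].

Lemma size_columns f : size (columns f) = n.
Proof. by rewrite size_map size_enum_ord. Qed.

Lemma nth_columns f (i : 'I_n) :
  nth empty (columns f) i = (nat_of_ord (f (ord0, i)), nat_of_ord (f (ord_max, i))).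
Proof. by rewrite (nth_map i) ?size_enum_ord // nth_ord_enum. Qed.

Lemma weight_columns f : weight f = total (columns f).
Proof.
rewrite /weight /total big_map big_enum /=.
transitivity (\sum_(r < 2) \sum_(i < n) f (r, i)).
  by rewrite pair_bigA; apply: eq_bigr => -[].
rewrite exchange_big; apply: eq_bigr => i _.
by rewrite big_ord_recl big_ord1; congr (_ + f (_, _)); apply: val_inj.
Qed.

Lemma columns_surj s :
  size s = n -> all (fun c : column => (c.1 < 3) && (c.2 < 3)) s ->
  exists f, columns f = s.
Proof.
move=> size_s s_lt3.
pose cell (u : ladder) := if u.1 == ord0 then (nth empty s u.2).1 else (nth empty s u.2).2.
exists [ffun u => inord (cell u)].
apply: (eq_from_nth (x0 := empty)); rewrite size_columns // => i i_lt.
have /andP[c1 c2] := all_nthP empty s_lt3 i ltac:(by rewrite size_s).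
rewrite -[i]/(nat_of_ord (Ordinal i_lt)) nth_columns !ffunE /cell /= !inordK //.
by case: (nth _ _ _).
Qed.

(** The shift by one lets [F 0] and [F n.+1] stand for absent columns beyond both ends, so end
    vertices obey the same formula. *)
Lemma sum_path_adj (F : nat -> nat) (i : 'I_n) : F 0 = 0 -> F n.+1 = 0 ->
  \sum_(j < n | path_adj i j) F j.+1 = F i + F i.+2.
Proof.
move=> F0 Fn; rewrite /path_adj.
rewrite (bigID (fun j : 'I_n => j.+1 == i)) /=; congr (_ + _).
  case: i => [[|i] i_lt] /=; first by rewrite F0 big1 // => j /andP[].
  rewrite (big_pred1 (Ordinal (ltnW i_lt))) // => j.
  by rewrite /= -(inj_eq val_inj) /=; lia.
have [i_lt|i_ge] := ltnP i.+1 n.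
  rewrite (big_pred1 (Ordinal i_lt)) // => j; rewrite /= -(inj_eq val_inj) /=; lia.
have -> : i.+2 = n.+1 by have := ltn_ord i; lia.
by rewrite Fn big1 // => j; have := ltn_ord j; lia.
Qed.

Lemma sum_ladder_adj f (r : 'I_2) (i : 'I_n) :
  \sum_(u | adj ((r, i) : ladder) u) f u =
    \sum_(j < n | path_adj i j) f (r, j) + f (rev_ord r, i).
Proof.
transitivity (\sum_(s < 2) \sum_(j < n | adj ((r, i) : ladder) (s, j)) f (s, j)).
  by rewrite pair_big_dep; apply: eq_big => -[].
rewrite (bigD1 r) //= (bigD1 (rev_ord r)) /=; last by case: r => [[|[|]]].
rewrite [X in _ + (_ + X)]big1 ?addn0; last first.
  move=> s; rewrite -!(inj_eq val_inj) /=.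
  by have := (ltn_ord s, ltn_ord r) => -[]; lia.
congr (_ + _).
  by apply: eq_bigl => j; rewrite /cart_adj /= eqxx /path_adj; lia.
rewrite (big_pred1 i) // => j.
by rewrite /= /cart_adj /= /path_adj -!(inj_eq val_inj) /=; have := ltn_ord r; lia.
Qed.

Lemma PID_columns f : PID_function f = italian empty (columns f).
Proof.
(* [row] will be [fst] or [snd]; the prepended [empty] realises the shift, and the default of [nth]
   supplies the right end. *)
have cell (r : 'I_2) (row : column -> nat) (i : 'I_n) : row empty = 0 ->
    (forall j : 'I_n, f (r, j) = row (nth empty (columns f) j) :> nat) ->
  \sum_(j < n | path_adj i j) f (r, j) =
    row (nth empty (empty :: columns f) i) + row (nth empty (columns f) i.+1).
  move=> row0 rowE.
  rewrite -(sum_path_adj (fun k => row (nth empty (empty :: columns f) k))) //.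
    by apply: eq_bigr => j _; rewrite rowE.
  by rewrite nth_default //= size_columns.
have okE (i : 'I_n) :
    column_ok (nth empty (empty :: columns f) i) (nth empty (columns f) i)
              (nth empty (columns f) i.+1) =
    [forall r : 'I_2, (f (r, i) == 0 :> nat) ==>
                       (\sum_(u | adj ((r, i) : ladder) u) f u == 2)].
  rewrite /column_ok /cell_ok nth_columns /=.
  have rev0 : rev_ord (ord0 : 'I_2) = ord_max by apply: val_inj.
  have rev1 : rev_ord (ord_max : 'I_2) = ord0 by apply: val_inj.
  have f0 j : f (ord0, j) = (nth empty (columns f) j).1 :> nat by rewrite nth_columns.
  have f1 j : f (ord_max, j) = (nth empty (columns f) j).2 :> nat by rewrite nth_columns.
  apply/andP/forallP => [[ok0 ok1] r | ok].
    have [->|->] : r = ord0 \/ r = ord_max.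
      by case: r => [[|[|r]] ?]; [left|right|]; rewrite ?ltnS //; apply: val_inj.
    - by rewrite sum_ladder_adj rev0 (cell _ fst).
    by rewrite sum_ladder_adj rev1 (cell _ snd).
  split; first by have := ok ord0; rewrite sum_ladder_adj rev0 (cell _ fst).
  by have := ok ord_max; rewrite sum_ladder_adj rev1 (cell _ snd).
apply/forallP/italianP => [pid i|ok [r i]].
  rewrite size_columns => i_lt.
  by rewrite (okE (Ordinal i_lt)); apply/forallP => r; apply: pid.
have := ok i; rewrite size_columns ltn_ord => /(_ isT).
by rewrite okE => /forallP.
Qed.

End Ladder.

Theorem theorem4p3 (n : nat) (n_ge1 : 1 <= n) :
  PID_number (path_graph 2 □ path_graph n) =
    if n \in [:: 1; 3; 5] then n + 1 else n.
Proof.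
have [[g g_PID g_min] le_weight] := PID_number_min (path_graph 2 □ path_graph n).
apply/eqP; rewrite eqn_leq; apply/andP; split.
  have [s [s_size s_lt3 s_ital <-]] := ex_italian n.
  have [f fE] := columns_surj n s s_size s_lt3.
  by rewrite -fE -weight_columns; apply: le_weight; rewrite PID_columns fE.
rewrite -g_min weight_columns; move: g_PID; rewrite PID_columns => g_ital.
have := size_columns n g; case: ifP => [n_exc sizeE|_ sizeE].
  by rewrite addn1 -{1}sizeE; apply: italian_total_exceptional; rewrite ?sizeE.
by rewrite -{1}sizeE; apply: italian_total.
Qed.
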